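(* The random variable $\mathfrak{X}$ is an invariant point, that is, $$\mathbf{P}\left[X^\sharp_t\big(\mathfrak{X}(\mathfrak{b}),\mathfrak{b}\big)=\mathfrak{X}(\theta_t\mathfrak{b})\ \text{ for all }t\ge0\right]=1 .$$
   Context: Let $\sigma:\mathbb{R}\to(0,\infty)$ and $m:\mathbb{R}\to\mathbb{R}$ be smooth functions such that $\int_{-\infty}^{0}\frac{1}{\sigma(x)}\exp\left(-\int_0^x\frac{2m}{\sigma^2}\right)dx=\int_{0}^{\infty}\frac{1}{\sigma(x)}\exp\left(-\int_0^x\frac{2m}{\sigma^2}\right)dx=\infty$ and $\Lambda:=\int_{\mathbb{R}}\frac{1}{\sigma(x)}\exp\left(\int_0^x\frac{2m}{\sigma^2}\right)dx<\infty$. Let $\mathfrak{b}=(b(t))_{t\in\mathbb{R}}$ be a two-sided standard Brownian motion on Wiener space, with shift $\theta_t\mathfrak{b}(r)=b(r+t)-b(t)$. $X^\sharp_t(x,\mathfrak{b})$ solves the Stratonovich SDE $X^\sharp_t=x+\int_0^t\sigma(X^\sharp_r)\circ db(r)-\int_0^t m(X^\sharp_r)\,dr$ up to an explosion time $\mathfrak{e}^\sharp(x,\mathfrak{b})$; after explosion the path stays forever at the point $+\infty$ or $-\infty$ to which it exploded. After removing a null set, it is regarded as a stochastic flow of local diffeomorphisms: for every $t\ge0$, $X^\sharp_t(\cdot,\mathfrak{b})$ is an increasing diffeomorphism of $\{x:t<\mathfrak{e}^\sharp(x,\mathfrak{b})\}$ onto $\mathbb{R}$, and $X^\sharp_{t+\tau}(x,\mathfrak{b})=X^\sharp_t(X^\sharp_\tau(x,\mathfrak{b}),\theta_\tau\mathfrak{b})$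 for $t,\tau\ge0$ and $x$ with $t+\tau<\mathfrak{e}^\sharp(x,\mathfrak{b})$. The random variable $\mathfrak{X}$ is $\mathfrak{X}(\mathfrak{b})=\inf\{x:\lim_{t\to\infty}X^\sharp_t(x,\mathfrak{b})=+\infty\}=\sup\{x:\lim_{t\to\infty}X^\sharp_t(x,\mathfrak{b})=-\infty\}$ (the two expressions are almost surely equal). *)

(* Defs.v *)
From HB Require Import structures.
From mathcomp Require Import all_boot all_order all_algebra.
From mathcomp Require Import all_classical all_reals all_analysis.
From mathcomp Require Import measurable_realfun.

Set Implicit Arguments.
Unset Strict Implicit.
Unset Printing Implicit Defensive.

Import Order.TTheory GRing.Theory Num.Theory.
Import numFieldNormedType.Exports.

Local Open Scope classical_set_scope.
Local Open Scope ring_scope.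

Section coefficients.
Context {R : realType}.
Local Notation mu := (@lebesgue_measure R).

(* Meaningful for open D: the derivatives at a point of an open set only
   depend on the values of f on that set. *)
Definition smooth_on (D : set R) (f : R -> R) : Prop :=
  forall (n : nat) (x : R), D x -> derivable (derive1n n f) x 1.

Definition oriented_integral (f : R -> R) (x : R) : R :=
  if 0 <= x then \int[mu]_(u in `[0, x]) f u
  else - \int[mu]_(u in `[x, 0]) f u.

Definition drift_exponent (sigma m : R -> R) (x : R) : R :=
  oriented_integral (fun u => 2 * m u / sigma u ^+ 2) x.

Definition speed_integral (sigma m : R -> R) (D : set R) : \bar R :=
  (\int[mu]_(x in D) ((sigma x)^-1 * expR (- drift_exponent sigma m x))%:E)%E.

Definition Lambda (sigma m : R -> R) : \bar R :=
  (\int[mu]_(x in setT) ((sigma x)^-1 * expR (drift_exponent sigma m x))%:E)%E.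

Definition increasing_diffeomorphism (D : set R) (f : R -> R) : Prop :=
  [/\ open D,
      {in D &, {homo f : x y / x < y}},
      smooth_on D f &
      exists g : R -> R,
        [/\ smooth_on setT g,
            (forall x, D x -> g (f x) = x) &
            (forall y, D (g y) /\ f (g y) = y)]].

End coefficients.

Record wiener (R : realType) : Type := Wiener {
  wiener_path :> R -> R ;
  wiener_continuous : continuous wiener_path ;
  wiener_at0 : wiener_path 0 = 0 }.

Section wiener_space.
Variable R : realType.

HB.instance Definition _ := gen_eqMixin (wiener R).
HB.instance Definition _ := gen_choiceMixin (wiener R).

Definition wiener_null : wiener R :=
  @Wiener R (fun=> 0) (fun x => @cst_continuous R R 0 x) erefl.

HB.instance Definition _ := isPointed.Build (wiener R) wiener_null.

Definition cylinders (T : set R) : set (set (wiener R)) :=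
  [set C | exists r B, [/\ T r, measurable B & C = [set b : wiener R | B (b r)]]].

Definition wiener_sigma (T : set R) : set (set (wiener R)) :=
  <<s cylinders T >>.

Fact wiener_display : measure_display. Proof. exact: default_measure_display. Qed.

Let wiener_measurable0 : wiener_sigma setT set0.
Proof. exact: sigma_algebra0. Qed.

Let wiener_measurableC A : wiener_sigma setT A -> wiener_sigma setT (~` A).
Proof. exact: sigma_algebraC. Qed.

Let wiener_measurable_bigcup (F : (set (wiener R))^nat) :
  (forall i, wiener_sigma setT (F i)) -> wiener_sigma setT (\bigcup_i F i).
Proof. exact: sigma_algebra_bigcup. Qed.

HB.instance Definition _ := @isMeasurable.Build wiener_display (wiener R)
  (wiener_sigma setT) wiener_measurable0 wiener_measurableC
  wiener_measurable_bigcup.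

Lemma wiener_shift_continuous (t : R) (b : wiener R) :
  continuous (fun r => b (r + t) - b t).
Proof.
move=> r; apply: cvgB; last exact: cvg_cst.
apply: (@continuous_comp _ _ _ (fun u : R => u + t) b);
  last exact: wiener_continuous.
by apply: cvgD; [exact: cvg_id | exact: cvg_cst].
Qed.

Lemma wiener_shift_at0 (t : R) (b : wiener R) : b (0 + t) - b t = 0.
Proof. by rewrite add0r subrr. Qed.

Definition wiener_shift (t : R) (b : wiener R) : wiener R :=
  Wiener (@wiener_shift_continuous t b) (@wiener_shift_at0 t b).

End wiener_space.

Section brownian_motion.
Context {R : realType}.
Variable P : probability (wiener R) R.

(* The coordinate process is a two-sided standard Brownian motion under P,
   i.e. P is the Wiener measure; continuity and b 0 = 0 are part of wiener R.
   The second parameter of normal_prob is the standard deviation. *)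
Definition two_sided_brownian_motion : Prop :=
  (forall (s t : R) (B : set R), s < t -> measurable B ->
    P [set b : wiener R | B (b t - b s)] =
    normal_prob 0 (Num.sqrt (t - s)) B) /\
  (forall (n : nat) (t : nat -> R) (B : nat -> set R),
    (forall i, t i < t i.+1) -> (forall i, measurable (B i)) ->
    P (\bigcap_(i < n) [set b : wiener R | B i (b (t i.+1) - b (t i))]) =
    (\prod_(i < n) P [set b : wiener R | B i (b (t i.+1) - b (t i))%R])%E).

(* Stated with an enclosing measurable event since Delta is only required
   to be measurable with respect to the completion of P. *)
Definition small_probability (Delta : wiener R -> R) (eps : R) : Prop :=
  exists A : set (wiener R), [/\ measurable A, (P A < eps%:E)%E &
    forall b, eps <= `|Delta b| -> A b].

Definition partition_of (t : R) (N : nat) (p : nat -> R) : Prop :=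
  [/\ p 0%N = 0, p N = t & forall i, (i < N)%N -> p i <= p i.+1].

Definition mesh_lt (N : nat) (p : nat -> R) (delta : R) : Prop :=
  forall i, (i < N)%N -> p i.+1 - p i < delta.

Definition trapezoidal_sum (Y Z : R -> wiener R -> R) (N : nat) (p : nat -> R)
    (b : wiener R) : R :=
  \sum_(i < N)
    (Y (p i) b + Y (p i.+1) b) / 2 * (Z (p i.+1) b - Z (p i) b).

(* I is the Stratonovich integral of Y against dZ over [0, t], i.e. the limit
   in probability of the trapezoidal sums as the mesh tends to 0. *)
Definition is_stratonovich_integral (Y Z : R -> wiener R -> R) (t : R)
    (I : wiener R -> R) : Prop :=
  forall eps : R, 0 < eps -> exists2 delta : R, 0 < delta &
    forall (N : nat) (p : nat -> R), partition_of t N p -> mesh_lt N p delta ->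
      small_probability (fun b => trapezoidal_sum Y Z N p b - I b) eps.

End brownian_motion.

Section flow.
Context {R : realType}.
Local Notation mu := (@lebesgue_measure R).
Variable P : probability (wiener R) R.
Variables sigma m : R -> R.
(* X t x b is the position at time t of the path started from x; it lies in
   [-oo, +oo] and is infinite exactly after the explosion. *)
Variable X : R -> R -> wiener R -> \bar R.

Definition explosion_time (x : R) (b : wiener R) : \bar R :=
  ereal_inf [set t%:E | t in [set t : R | 0 <= t /\ X t x b \isn't a fin_num]].

Definition exit_time (n : nat) (x : R) (b : wiener R) : \bar R :=
  ereal_inf [set t%:E | t in [set t : R | 0 <= t /\ (n%:R%:E <= `|X t x b|)%E]].

(* t /\ tau_n, where tau_n is the exit time of (-n, n). *)
Definition stopped_clock (n : nat) (x t : R) (b : wiener R) : R :=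
  fine (mine t%:E (exit_time n x b)).

Definition adapted : Prop :=
  forall (t x : R) (B : set (\bar R)), 0 <= t -> measurable B ->
    exists2 A, wiener_sigma `[0, t] A &
      {ae P, forall b, A b <-> B (X t x b)}.

(* X = x + \int sigma(X) o db - \int m(X) dr up to the explosion time means
   up to the exit time of (-n, n), for every n. Past the exit time the stopped
   driving path is constant and contributes nothing to the integral. *)
Definition solves_stratonovich_sde : Prop :=
  adapted /\
  forall (n : nat) (x t : R), 0 <= t ->
    is_stratonovich_integral P
      (fun s b => sigma (fine (X (stopped_clock n x s b) x b)))
      (fun s b => b (stopped_clock n x s b))
      t
      (fun b => fine (X (stopped_clock n x t b) x b) - x
         + \int[mu]_(r in `[0, stopped_clock n x t b]) m (fine (X r x b))).

Definition path_until_explosion (x : R) (b : wiener R) : Prop :=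
  [/\ X 0 x b = x%:E,
      {within [set t : R | 0 <= t], continuous (fun t : R => X t x b)} &
      forall s t : R, 0 <= s -> s <= t -> X s x b \isn't a fin_num ->
        X t x b = X s x b].

Definition flow_diffeomorphisms (b : wiener R) : Prop :=
  forall t : R, 0 <= t ->
    increasing_diffeomorphism [set x : R | (t%:E < explosion_time x b)%E]
      (fun x : R => fine (X t x b)).

Definition flow_cocycle (b : wiener R) : Prop :=
  forall t tau x : R, 0 <= t -> 0 <= tau ->
    ((t + tau)%:E < explosion_time x b)%E ->
    X (t + tau) x b = X t (fine (X tau x b)) (wiener_shift tau b).

(* N is the null set to be removed; as the cocycle identity involves the
   shifted path, what remains has to be stable under the shifts. *)
Definition stochastic_flow : Prop :=
  exists N : set (wiener R),
    [/\ P.-negligible N,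
        (forall (t : R) (b : wiener R), 0 <= t -> ~ N b -> ~ N (wiener_shift t b)) &
        forall b, ~ N b ->
          [/\ forall x : R, path_until_explosion x b,
              flow_diffeomorphisms b & flow_cocycle b]].

Definition frakX (b : wiener R) : \bar R :=
  ereal_inf [set x%:E | x in [set x : R | X t x b @[t --> +oo] --> +oo%E]].

Definition frakX_sup (b : wiener R) : \bar R :=
  ereal_sup [set x%:E | x in [set x : R | X t x b @[t --> +oo] --> -oo%E]].

End flow.

(* Main.v *)
Require Import Defs.
From HB Require Import structures.
From mathcomp Require Import all_boot all_order all_algebra.
From mathcomp Require Import all_classical all_reals all_analysis.
From mathcomp Require Import measurable_realfun.
Import Order.TTheory GRing.Theory Num.Theory.
Import numFieldNormedType.Exports.
Local Open Scope classical_set_scope.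
Local Open Scope ring_scope.

Set Implicit Arguments.
Unset Strict Implicit.

(** The flow transports the sets of initial points that escape to [-oo] and
    to [+oo]: if [x] has not exploded by time [t], then [x] escapes to [l]
    under [b] iff [X t x b] escapes to [l] under the shifted path
    ([escape_set_shift]).  Since [X t] is an increasing bijection from an
    interval [D t], the points alive at time [t], onto the real line, it must
    then send the threshold [a = frakX b] between the two sets to the
    threshold of the shifted path ([frakX_wiener_shift]).

    What has to be excluded is that [a] itself explodes.  Suppose that the
    threshold of the shifted path at time [t] is finite and equal to both its
    expressions.  Then some point escapes to [-oo] and some point escapes to
    [+oo] under the shifted path.  Their preimages under [X t] belong to
    [D t], and they lie on either side of [a] because they escape to [-oo] and
    [+oo] under [b]; as [D t] is an interval, [a] is alive at time [t]
    ([alive_frakX]).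

    An uncountable family of times is handled by monotonicity: a point alive
    at time [n] is alive before, so it suffices to know that the threshold is
    finite along the shifted paths at all natural times.  This is almost
    surely so because each fixed shift preserves the Wiener measure
    ([brownian_shift_invariant]): the increments of the shifted path over a
    grid are the increments over the translated grid, they have the same
    product law, and the laws of the increments over all finite grids
    determine a finite measure on the path space
    ([increment_events_determine]). *)

(** * Shift invariance of the Wiener measure *)

(** The grid is indexed by all natural numbers, as in the independence of
    Brownian increments; past the given times it goes on with unit steps. *)
Lemma strictly_increasing_enumeration (R : realType) (s : seq R) :
  exists (t : nat -> R) (n : nat), (forall i, t i < t i.+1) /\
    (forall r, r \in s -> exists2 k, (k <= n)%N & t k = r).
Proof.
pose u := sort <=%R (undup s).
have usorted : sorted <%R u by rewrite sort_lt_sorted undup_uniq.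
pose t i := if (i < size u)%N then u`_i else last 0 u + (i.+1 - size u)%:R.
exists t, (size u); split.
  move=> i; rewrite /t; case: (ltnP i.+1 (size u)) => iu.
    rewrite (ltn_trans (ltnSn i) iu).
    by rewrite (lt_sorted_ltn_nth 0 usorted) // inE ?(ltn_trans (ltnSn i) iu).
  case: (ltnP i (size u)) => ui.
    have us : size u = i.+1 by apply/eqP; rewrite eqn_leq iu ui.
    by rewrite -nth_last us /= ltrDl ltr0n subn_gt0.
  by rewrite ltrD2l ltr_nat ltn_sub2r // ltnS (leq_trans ui).
move=> r rs; have ru : r \in u by rewrite mem_sort mem_undup.
exists (index r u); first exact: index_size.
by rewrite /t index_mem ru nth_index.
Qed.

Section path_space.
Context {R : realType}.
Implicit Types (r tau : R) (n : nat) (t : nat -> R) (B : nat -> set R)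
  (A : set (wiener R)).

Lemma measurable_coordinate (r : R) :
  measurable_fun [set: wiener R] (fun b : wiener R => b r).
Proof.
by move=> _ B mB; rewrite setTI; apply: sub_sigma_algebra; exists r, B.
Qed.

Lemma measurable_wiener_shift tau :
  measurable_fun [set: wiener R] (@wiener_shift R tau).
Proof.
apply: (@measurability _ _ _ _ _ _ (@cylinders R setT)) => //.
move=> _ [_ [r [B [_ mB ->]]] <-].
apply: (measurable_funB (measurable_coordinate (r + tau))
  (measurable_coordinate tau)) => //.
Qed.

Definition increment_event (n : nat) (t : nat -> R) (B : nat -> set R) :
    set (wiener R) :=
  \bigcap_(i < n) [set b : wiener R | B i (b (t i.+1) - b (t i))].

Definition increment_events (n : nat) (t : nat -> R) :
    set (set (wiener R)) :=
  [set A | exists2 B : nat -> set R, forall i, measurable (B i) &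
           A = increment_event n t B].

Lemma increment_events_setI n t : setI_closed (increment_events n t).
Proof.
move=> _ _ [B mB ->] [C mC ->]; exists (fun i => B i `&` C i).
  by move=> i; exact: measurableI.
by rewrite /increment_event -bigcapI; apply: eq_bigcapr.
Qed.

Lemma increment_events_setT n t : increment_events n t setT.
Proof.
exists (fun=> setT); first by move=> _; exact: measurableT.
by apply/seteqP; split.
Qed.

Lemma measurable_increment_event n t B : (forall i, measurable (B i)) ->
  measurable (increment_event n t B).
Proof.
move=> mB; apply: bigcap_measurableType => i _.
rewrite -[X in measurable X]setTI.
exact: (measurable_funB (measurable_coordinate (t i.+1))
  (measurable_coordinate (t i))).
Qed.

(** The increment from [t 0] to [t k] telescopes into consecutive increments,
    and each of these generates events in which the other factors are
    [setT]. *)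
Lemma measurable_grid_increment (n k : nat) (t : nat -> R) : (k <= n)%N ->
  measurable_fun [set: g_sigma_algebraType (increment_events n t)]
    (fun b : wiener R => b (t k) - b (t 0%N)).
Proof.
elim: k => [_|k IH kn].
  rewrite (_ : (fun _ => _) = cst 0); first exact: measurable_cst.
  by apply/funext => b; rewrite subrr.
rewrite (_ : (fun _ => _) = (fun b : wiener R =>
    (b (t k) - b (t 0%N)) + (b (t k.+1) - b (t k)))); last first.
  by apply/funext => b; rewrite [RHS]addrC addrA subrK.
apply: measurable_funD; first exact: IH (ltnW kn).
move=> _ C mC; rewrite setTI; apply: (@sub_sigma_algebra _ setT (increment_events n t)).
exists (fun i => if i == k then C else setT).
  by move=> i; case: eqP => // _; exact: measurableT.
apply/seteqP; split=> b.
  by move=> Cb i /= _; case: eqP => [->|].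
by move=> /(_ k kn); rewrite /= eqxx.
Qed.

(** Adding the time [0] to the grid makes the position at a grid time [r] an
    increment, because paths vanish at [0]. *)
Lemma wiener_sigma_sub_increments (s : seq R) :
  exists (t : nat -> R) (n : nat), (forall i, t i < t i.+1) /\
    wiener_sigma [set` s] `<=` <<s increment_events n t>>.
Proof.
have [t [n [tS ts]]] := strictly_increasing_enumeration (0 :: s).
exists t, n; split=> //; apply: smallest_sub; first exact: smallest_sigma_algebra.
move=> _ [r [B [/= rs mB ->]]].
have [k kn tk] : exists2 k, (k <= n)%N & t k = r by apply: ts; rewrite in_cons rs orbT.
have [j jn tj] : exists2 j, (j <= n)%N & t j = 0 by apply: ts; rewrite mem_head.
have := measurable_funB (measurable_grid_increment (t := t) kn)
  (measurable_grid_increment (t := t) jn) measurableT mB.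
rewrite setTI; congr (<<s _ >> _).
apply/seteqP; split => b /=;
  by rewrite tk tj wiener_at0 sub0r opprK subrK.
Qed.

(** Two events that depend on finitely many times both depend on the union
    of these times, so the events of this kind form a pi-system even though
    increment events over different grids do not. *)
Lemma wiener_sigma_finite_times_setI :
  setI_closed [set A | exists s : seq R, wiener_sigma [set` s] A].
Proof.
move=> A B [s sA] [s' sB]; exists (s ++ s').
have sub u : {subset u <= s ++ s'} ->
    wiener_sigma [set` u] `<=` wiener_sigma [set` s ++ s'].
  move=> us; apply: sub_sigma_algebra2 => _ [r [C [/= /us rs mC ->]]].
  by exists r, C.
have sA' : wiener_sigma [set` s ++ s'] A.
  have /sub/(_ A sA) : {subset s <= s ++ s'} by move=> x xs; rewrite mem_cat xs.
  exact.
have sB' : wiener_sigma [set` s ++ s'] B.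
  have /sub/(_ B sB) : {subset s' <= s ++ s'}.
    by move=> x xs; rewrite mem_cat xs orbT.
  exact.
exact: (@measurableI _ (g_sigma_algebraType (cylinders [set` s ++ s']))).
Qed.

(** The pi-lambda theorem is used twice: over one grid, to pass from products
    of increments to the sigma-algebra of the grid, and then over the union of
    these sigma-algebras, which generates the whole sigma-algebra. *)
Lemma increment_events_determine (m1 m2 : {measure set (wiener R) -> \bar R}) :
  (m1 setT < +oo)%E ->
  (forall n t B, (forall i, t i < t i.+1) -> (forall i, measurable (B i)) ->
     m1 (increment_event n t B) = m2 (increment_event n t B)) ->
  forall A, measurable A -> m1 A = m2 A.
Proof.
move=> m1fin m12.
have m12s (s : seq R) A : wiener_sigma [set` s] A -> m1 A = m2 A.
  have [t [n [tS sub]]] := wiener_sigma_sub_increments s.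
  move=> /sub; move: A.
  apply: (g_sigma_algebra_measure_unique (increment_events n t) _ (fun=> setT)).
  - by move=> _ [B mB ->]; exact: measurable_increment_event.
  - by move=> _; exact: increment_events_setT.
  - by rewrite bigcup_const//; exists 0%N.
  - exact: increment_events_setI.
  - by move=> _ [B mB ->]; exact: m12.
  - by [].
apply: (measure_unique [set A | exists s : seq R, wiener_sigma [set` s] A]
  (fun=> setT)) => //.
- apply/seteqP; split.
    apply: sub_sigma_algebra2 => _ [r [B [_ mB ->]]].
    exists [:: r]; apply: sub_sigma_algebra; exists r, B; split => //=.
    by rewrite mem_seq1.
  apply: smallest_sub; first exact: sigma_algebra_measurable.
  move=> A [s]; apply: sub_sigma_algebra2 => _ [r [B [_ mB ->]]].
  by exists r, B.
- exact: wiener_sigma_finite_times_setI.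
- by move=> _; exists [::]; rewrite -setC0; apply: sigma_algebraC; exact: sigma_algebra0.
- by rewrite bigcup_const//; exists 0%N.
- by move=> A [s] /m12s.
Qed.

Variable P : probability (wiener R) R.
Hypothesis bm : two_sided_brownian_motion P.

Lemma wiener_shift_increment_event tau n t B :
  @wiener_shift R tau @^-1` increment_event n t B =
  increment_event n (fun i => t i + tau) B.
Proof.
by apply/seteqP; split=> b Bb i /= /Bb /=; rewrite opprB addrA subrK.
Qed.

Lemma brownian_shift_invariant tau A : measurable A ->
  P (@wiener_shift R tau @^-1` A) = P A.
Proof.
move=> mA; have ms := @measurable_wiener_shift tau.
rewrite -[LHS]/(pushforward P (@wiener_shift R tau) A).
apply: increment_events_determine => //=.
  by rewrite /pushforward preimage_setT probability_setT ltry.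
move=> n t B tS mB; have [law indep] := bm.
have tauS i : t i + tau < t i.+1 + tau by rewrite ltrD2r.
rewrite /pushforward wiener_shift_increment_event.
rewrite /increment_event (indep n _ _ tauS mB) (indep n _ _ tS mB).
apply: eq_bigr => i _.
rewrite (law _ _ _ (tauS i) (mB i)) (law _ _ _ (tS i) (mB i)).
by rewrite opprD addrACA subrr addr0.
Qed.

Lemma ae_wiener_shift tau (Q : wiener R -> Prop) :
  {ae P, forall b, Q b} -> {ae P, forall b, Q (wiener_shift tau b)}.
Proof.
case=> A [mA PA0 QA]; exists (@wiener_shift R tau @^-1` A); split.
- by rewrite -[X in measurable X]setTI; exact: measurable_wiener_shift.
- by rewrite brownian_shift_invariant.
- by move=> b /= nQ; exact: QA.
Qed.

End path_space.

(** * Limits along half-lines and increasing diffeomorphisms *)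

Lemma cvg_pinfty_shift {R : realType} {T : topologicalType} (f g : R -> T)
    (t : R) (l : T) : 0 <= t -> (forall s, 0 <= s -> f (t + s) = g s) ->
  f s @[s --> +oo] --> l <-> g s @[s --> +oo] --> l.
Proof.
move=> t0 fg; split=> h A /h [M [Mreal MA]].
  exists (`|M|); split; first exact: num_real.
  move=> s Ms; have s0 : 0 <= s by rewrite ltW// (le_lt_trans _ Ms).
  rewrite /= -fg//; apply: MA; apply: (le_lt_trans (ler_norm M)).
  by rewrite (lt_le_trans Ms)// lerDr.
exists (`|M| + t); split; first exact: num_real.
move=> s Ms; have Mst : `|M| < s - t by rewrite ltrBrDr.
rewrite /= -[s](addrNK t) addrC fg; last by rewrite ltW// (le_lt_trans _ Mst).
by apply: MA; rewrite (le_lt_trans (ler_norm M)).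
Qed.

(** With [c = t] and [c = 0], this gives the left limits of the two sides of
    the cocycle identity as functions of the time elapsed since [t]. *)
Lemma halfline_continuous_cvg_left {R : realType} {T : topologicalType}
    (f : R -> T) (c s : R) : 0 <= c -> 0 < s ->
  {within [set t : R | 0 <= t], continuous f} ->
  f (c + r) @[r --> s^'-] --> f (c + s).
Proof.
move=> c0 s0 /subspace_continuousP cf.
have cs0 : [set t : R | 0 <= t] (c + s) by rewrite /= addr_ge0// ltW.
move=> A /(cf _ cs0); rewrite /nbhs/= /within/= => fA.
have cshift : c + r @[r --> s] --> c + s.
  by apply: cvgD; [exact: cvg_cst|exact: cvg_id].
have := cshift _ fA; rewrite /nbhs/= => cA.
change (\forall r \near s, r < s -> A (f (c + r))).
apply: (@filterS2 _ (nbhs s) _ _ _ _ _ cA (lt_nbhsr s0)) => r; rewrite /= => fAr r0 _.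
by apply: fAr; rewrite addr_ge0// ltW.
Qed.

Section diffeomorphism.
Context {R : realType} {D : set R} {f : R -> R}.
Hypothesis Df : increasing_diffeomorphism D f.

Lemma diffeomorphism_le x y : D x -> D y -> x <= y -> f x <= f y.
Proof.
case: Df => _ fmono _ _ Dx Dy; rewrite le_eqVlt => /predU1P[->//|xy].
by apply/ltW/fmono; rewrite ?inE.
Qed.

Lemma diffeomorphism_surjective y : exists2 x, D x & f x = y.
Proof. by case: Df => _ _ _ [g [_ _ fg]]; exists (g y); case: (fg y). Qed.

(** [D] is the image of the line under the continuous inverse of [f]. *)
Lemma diffeomorphism_interval x y z : D x -> D z -> x <= y <= z -> D y.
Proof.
move=> Dx Dz /andP[xy yz]; have fxz := diffeomorphism_le Dx Dz (le_trans xy yz).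
case: Df => _ _ _ [g [gsm gf fg]].
have cg : continuous g.
  by move=> w; apply: differentiable_continuous; apply/derivable1_diffP; exact: (gsm 0%N).
have [||w _ <-] := @IVT R g (f x) (f z) y fxz.
- by apply: continuous_subspaceT.
- by rewrite !gf// ge_min xy/= le_max yz orbT.
by case: (fg w).
Qed.

End diffeomorphism.

(** * Explosion and the cocycle identity *)

Section pathwise.
Context {R : realType}.
Variable X : R -> R -> wiener R -> \bar R.
Implicit Types (x y s t : R) (b : wiener R).

Lemma finite_before_explosion s t x b : 0 <= s -> s <= t ->
  (t%:E < explosion_time X x b)%E -> X s x b \is a fin_num.
Proof.
move=> s0 st te; apply: contraT => infX.
have : (explosion_time X x b <= s%:E)%E.
  by apply: ereal_inf_lbound; exists s.
by move=> /(lt_le_trans te); rewrite lte_fin ltNge st.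
Qed.

(** Finiteness is an open condition, so a path that is finite at time [t]
    stays finite a little longer; before [t] it is finite since infinite
    values are absorbing. *)
Lemma lt_explosion_time t x b : path_until_explosion X x b -> 0 <= t ->
  X t x b \is a fin_num -> (t%:E < explosion_time X x b)%E.
Proof.
move=> [_ /subspace_continuousP cX absX] t0 finX.
have : nbhs (X t x b) [set z : \bar R | z \is a fin_num].
  rewrite -(fineK finX).
  by rewrite /nbhs/=; apply: filterE.
move=> /(cX _ t0); rewrite /nbhs/= /within/= => /nbhs_ballP[e /= e0 eX].
apply: (@lt_le_trans _ _ (t + e)%:E); first by rewrite lte_fin ltrDl.
apply: le_ereal_inf_tmp => _ [s [s0 infs] <-]; rewrite lee_fin leNgt.
apply/negP => ste; move/negP: infs; apply.
have [st|ts] := leP s t.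
  by apply: contraT => infs; rewrite -(negbTE infs) -(absX s t).
apply: eX => //=; rewrite /ball/= ltr_distlC.
by rewrite ste andbT (lt_trans _ ts)// ltrBlDr ltrDl.
Qed.

(** The cocycle identity extends past the explosion time: both sides agree
    before it, hence at it by left continuity, and then both stay at the
    infinite value reached there. *)
Lemma flow_cocycle_through_explosion s t x b :
  flow_cocycle X b -> path_until_explosion X x b ->
  path_until_explosion X (fine (X t x b)) (wiener_shift t b) ->
  0 <= s -> 0 <= t -> (t%:E < explosion_time X x b)%E ->
  X (t + s) x b = X s (fine (X t x b)) (wiener_shift t b).
Proof.
move=> coc px py s0 t0 te.
have [ts|ets] := ltP (t + s)%:E (explosion_time X x b).
  by rewrite addrC coc// addrC.
(* Otherwise the explosion time is a real number E, with t < E <= t + s. *)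
have : explosion_time X x b \is a fin_num.
  by rewrite ge0_fin_numE ?(le_lt_trans ets) ?ltry// (le_trans _ (ltW te))// lee_fin.
move=> /fineK eE; move: te ets; rewrite -eE; set E := fine _ => te ets.
rewrite lte_fin in te; rewrite lee_fin in ets.
have E0 : 0 <= E by rewrite (le_trans t0) ?ltW.
have infE : X E x b \isn't a fin_num.
  by apply/negP => /(lt_explosion_time px E0); rewrite -eE ltxx.
have [_ cx absx] := px; have [_ cy absy] := py.
have Et0 : 0 < E - t by rewrite subr_gt0.
have XE : X E x b = X (E - t) (fine (X t x b)) (wiener_shift t b).
  have /= c1 := halfline_continuous_cvg_left t0 Et0 cx.
  have /= c2 := halfline_continuous_cvg_left (lexx 0) Et0 cy.
  rewrite [t + (E - t)]addrC subrK in c1; rewrite add0r in c2.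
  apply: (cvg_unique _ c1); first exact: ereal_hausdorff.
  apply: cvg_trans c2; apply: near_eq_cvg; near=> r.
  have rE : r < E - t by near: r; exact: withinT.
  have r0 : 0 <= r by apply/ltW; near: r; exact: nbhs_left_gt.
  rewrite add0r [t + r]addrC coc// -eE lte_fin.
  by rewrite -ltrBrDr.
rewrite (absx E)//.
rewrite (absy (E - t)) -?XE//; first exact: ltW.
by rewrite lerBlDl.
Unshelve. all: by end_near. Qed.

(** * The threshold between the escape sets *)

Definition escape_set (l : \bar R) b : set R :=
  [set x | X t x b @[t --> +oo] --> l].

(** The almost sure property of the threshold that has to be inherited by the
    shifted paths. *)
Definition critical_point b : Prop :=
  frakX X b \is a fin_num /\ frakX X b = frakX_sup X b.

Lemma frakX_between_escape_sets b x y : critical_point b ->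
  escape_set -oo b x -> escape_set +oo b y -> x <= fine (frakX X b) <= y.
Proof.
move=> [finb eqb] xb yb; rewrite -!lee_fin fineK//; apply/andP; split.
  by rewrite eqb; apply: ereal_sup_ubound; exists x.
by apply: ereal_inf_lbound; exists y.
Qed.

Lemma escape_sets_neq0 b : critical_point b ->
  escape_set -oo b !=set0 /\ escape_set +oo b !=set0.
Proof.
move=> [finb eqb]; split; apply/set0P/eqP => e0.
  by move: finb; rewrite eqb /frakX_sup -/(escape_set -oo b) e0 image_set0 ereal_sup0.
by move: finb; rewrite /frakX -/(escape_set +oo b) e0 image_set0 ereal_inf0.
Qed.

Section one_time.
Variables (b : wiener R) (t : R).
Hypothesis t0 : 0 <= t.
Hypothesis path_b : forall x, path_until_explosion X x b.
Hypothesis path_shift : forall x, path_until_explosion X x (wiener_shift t b).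
Hypothesis diffeo : flow_diffeomorphisms X b.
Hypothesis cocycle : flow_cocycle X b.

Local Notation alive := [set x : R | (t%:E < explosion_time X x b)%E].
Local Notation phi := (fun x : R => fine (X t x b)).

Lemma escape_set_shift l x : alive x ->
  escape_set l b x <-> escape_set l (wiener_shift t b) (phi x).
Proof.
move=> ax; apply: (cvg_pinfty_shift _ t0) => s s0.
exact: flow_cocycle_through_explosion.
Qed.

(** The threshold lies between the preimages of two points that escape in
    opposite directions after time [t], and alive points form an interval. *)
Lemma alive_frakX : critical_point b -> critical_point (wiener_shift t b) ->
  alive (fine (frakX X b)).
Proof.
move=> cb ct; have [[y ym] [z zp]] := escape_sets_neq0 ct.
have [u au uy] := diffeomorphism_surjective (diffeo t0) y.
have [v av vz] := diffeomorphism_surjective (diffeo t0) z.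
apply: (diffeomorphism_interval (diffeo t0) au av).
apply: frakX_between_escape_sets => //; apply/escape_set_shift => //.
- by rewrite uy.
- by rewrite vz.
Qed.

(** Any point above the image of the threshold comes from an alive point
    [v > frakX X b].  Between the threshold and [v] there is a point that
    escapes to [+oo]; it is alive by convexity, so its image escapes as well. *)
Lemma frakX_wiener_shift : frakX X b \is a fin_num ->
  alive (fine (frakX X b)) ->
  frakX X (wiener_shift t b) = X t (fine (frakX X b)) b.
Proof.
set a := fine _ => finb aa.
have aE : a%:E = frakX X b by rewrite fineK.
rewrite -[RHS]fineK; last exact: finite_before_explosion aa.
apply/eqP; rewrite eq_le; apply/andP; split; last first.
  apply: le_ereal_inf_tmp => _ [y yp <-].
  have [v av vy] := diffeomorphism_surjective (diffeo t0) y.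
  rewrite lee_fin -vy; apply: (diffeomorphism_le (diffeo t0)) => //.
  rewrite -lee_fin aE; apply: ereal_inf_lbound; exists v => //.
  by apply/(escape_set_shift +oo av); rewrite /= vy.
apply/lee_addgt0Pr => e e0; rewrite -EFinD.
have [v av vz] := diffeomorphism_surjective (diffeo t0) (phi a + e).
have av_lt : a < v.
  rewrite ltNge; apply/negP => /(diffeomorphism_le (diffeo t0) av aa).
  by rewrite vz leNgt ltrDl e0.
have : (frakX X b < v%:E)%E by rewrite -aE lte_fin.
move=> /ereal_inf_lt[_ [u up <-]]; rewrite lte_fin => uv.
have au : a <= u by rewrite -lee_fin aE; apply: ereal_inf_lbound; exists u.
have alu : alive u.
  by apply: (diffeomorphism_interval (diffeo t0) aa av); rewrite au ltW.
apply: (@le_trans _ _ (phi u)%:E).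
  by apply: ereal_inf_lbound; exists (phi u) => //; exact/escape_set_shift.
by rewrite lee_fin -vz; apply: (diffeomorphism_le (diffeo t0)) => //; exact: ltW.
Qed.

End one_time.

End pathwise.

(** * Invariance of the threshold *)

Theorem theorem5p1 (R : realType) (sigma m : R -> R)
    (P : probability (wiener R) R) (X : R -> R -> wiener R -> \bar R)
    (sigma_gt0 : forall x, 0 < sigma x)
    (sigma_smooth : smooth_on setT sigma)
    (m_smooth : smooth_on setT m)
    (speed_left : speed_integral sigma m `]-oo, 0] = +oo%E)
    (speed_right : speed_integral sigma m `[0, +oo[ = +oo%E)
    (Lambda_fin : (Lambda sigma m < +oo)%E)
    (bm : two_sided_brownian_motion P)
    (sde : solves_stratonovich_sde P sigma m X)
    (flow : stochastic_flow P X)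
    (frakX_ae : {ae P, forall b,
       frakX X b \is a fin_num /\ frakX X b = frakX_sup X b}) :
  {ae P, forall b, forall t : R, 0 <= t ->
     frakX X (wiener_shift t b) \is a fin_num /\
     X t (fine (frakX X b)) b = frakX X (wiener_shift t b)}.
Proof.
have [N [N0 Nshift regular]] := flow.
have critical_grid : {ae P, forall b, forall n : nat,
    critical_point X (wiener_shift n%:R b)}.
  by apply: ae_foralln => n; exact: (ae_wiener_shift bm).
have regular_ae : {ae P, forall b, ~ N b}.
  by apply: negligibleS N0 => b /contrapT.
apply: filterS3 critical_grid regular_ae frakX_ae => b crit nNb cb t t0.
have [path_b diffeo cocycle] := regular b nNb.
have path_shift s : 0 <= s ->
    forall x, path_until_explosion X x (wiener_shift s b).
  by move=> s0 x; have [] := regular _ (Nshift s b s0 nNb).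
have [n tn] : exists n : nat, t <= n%:R.
  by exists (Num.truncn t).+1; rewrite ltW// truncnS_gt.
have n0 : 0 <= n%:R :> R by [].
have alive_n := alive_frakX n0 path_b (path_shift _ n0) diffeo cocycle cb (crit n).
have alive_t : (t%:E < explosion_time X (fine (frakX X b)) b)%E.
  by apply: le_lt_trans alive_n; rewrite lee_fin.
rewrite (frakX_wiener_shift t0 path_b (path_shift t t0) diffeo cocycle cb.1 alive_t).
by split=> //; exact: finite_before_explosion alive_t.
Qed.
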